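(* For all $n\geq 1$, the number of desarrangements of length $n$ avoiding both $132$ and $321$ is $d_n(132,321)=n-1$.
   Context: Permutations are in one-line notation. An index $i\in[n-1]$ is a descent of $\pi\in\mathfrak{S}_n$ if $\pi_i>\pi_{i+1}$; $i\in[n]$ is an ascent if it is not a descent (so $n$ is always an ascent). A desarrangement is a permutation whose first ascent is even. $d_n(\Pi)$ is the number of desarrangements in $\mathfrak{S}_n$ avoiding every pattern in $\Pi$ ($\pi$ avoids $\sigma$ if no subsequence of $\pi$ has the same relative order as $\sigma$). *)

(* Defs.v *)
From mathcomp Require Import all_boot all_fingroup.

Set Implicit Arguments.
Unset Strict Implicit.
Unset Printing Implicit Defensive.

(* One-line notation with values in {1, ..., n}.  Positions are 1-based below,
   so the i-th letter of w is nth 0 w i.-1. *)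
Definition oneline n (p : 'S_n) : seq nat := [seq (val (p i)).+1 | i <- enum 'I_n].

Definition letter (w : seq nat) (i : nat) : nat := nth 0 w i.-1.

Definition is_descent (w : seq nat) (i : nat) : bool :=
  (1 <= i < size w) && (letter w i > letter w i.+1).

Definition is_ascent (w : seq nat) (i : nat) : bool :=
  (1 <= i <= size w) && ~~ is_descent w i.

Definition is_first_ascent (w : seq nat) (i : nat) : bool :=
  is_ascent w i && [forall j : 'I_i, ~~ is_ascent w j].

Definition desarrangement n (p : 'S_n) : bool :=
  [exists i : 'I_n.+1, is_first_ascent (oneline p) i && ~~ odd i].

Definition same_order (s t : seq nat) : bool :=
  (size s == size t) &&
  [forall i : 'I_(size s), forall j : 'I_(size s),
     (nth 0 s i < nth 0 s j) == (nth 0 t i < nth 0 t j)].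

(* Subsequences of w are exactly the mask m w with m of length size w;
   see containsP. *)
Definition contains (w sigma : seq nat) : bool :=
  [exists m : (size w).-tuple bool, same_order (mask m w) sigma].

Lemma containsP (w sigma : seq nat) :
  reflect (exists2 s, subseq s w & same_order s sigma) (contains w sigma).
Proof.
apply: (iffP existsP) => [[m sm]|[s /subseqP[m sz_m ->] sm]].
  by exists (mask m w) => //; apply: mask_subseq.
by exists (Tuple (introT eqP sz_m)).
Qed.

Definition avoids n (p : 'S_n) (sigma : seq nat) : bool :=
  ~~ contains (oneline p) sigma.

(* Patterns are given by their one-line notation. *)
Definition d (n : nat) (Pi : seq (seq nat)) : nat :=
  #|[set p : 'S_n | desarrangement p && all (avoids p) Pi]|.

(* Main.v *)
Require Import Defs.
From mathcomp Require Import all_boot all_order all_fingroup zify.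

(** In a desarrangement the first position is a descent.  Avoiding [321] then
    forces the second letter to be [1], since a smaller letter further right
    would complete a [321]; and avoiding [132] forces everything after this [1]
    to increase.  So the permutation is determined by its first letter, which
    can be anything but [1]. *)

Set Implicit Arguments.
Unset Strict Implicit.
Unset Printing Implicit Defensive.

Import Order.TTheory.

Lemma perm_homo1 n (s : 'S_n) : {homo s : i j / i < j} -> s = 1%g.
Proof.
move=> s_incr; apply/permP=> i; rewrite perm1.
by apply: (Order.mono_unique le_total _ (le_mono s_incr)) => // j k.
Qed.

Lemma exists_lift_perm n (p : 'S_n.+1) (i : 'I_n.+1) :
  exists s : 'S_n, p = lift_perm i (p i) s.
Proof.
have p_lift k : p i != p (lift i k) by rewrite (inj_eq perm_inj) neq_lift.
pose s k := s2val (unlift_some (p_lift k)).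
have sE k : p (lift i k) = lift (p i) (s k) := s2valP (unlift_some (p_lift k)).
have s_inj : injective s.
  by move=> j k /(congr1 (lift (p i))); rewrite -!sE => /perm_inj/lift_inj.
exists (perm s_inj); apply/permP=> j.
case: (unliftP i j) => [k|] ->; last by rewrite lift_perm_id.
by rewrite lift_perm_lift permE.
Qed.

Lemma ltn_lift n (i : 'I_n.+1) (j k : 'I_n) : (lift i j < lift i k) = (j < k).
Proof. by rewrite !ltnNge /= leq_bump2. Qed.

Lemma lift_perm1_homoP n (p : 'S_n.+1) (i : 'I_n.+1) :
  reflect {in predC1 i &, {homo p : j k / j < k}}
          (p == lift_perm i (p i) 1).
Proof.
apply: (iffP eqP) => [-> j k|p_incr]; rewrite ?inE.
  case: (unliftP i j) => [j' ->|->]; last by rewrite eqxx.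
  case: (unliftP i k) => [k' ->|->]; last by rewrite eqxx.
  by rewrite !lift_perm_lift !perm1 !ltn_lift.
have [s def_p] := exists_lift_perm p i.
rewrite {1}def_p; congr lift_perm; apply: perm_homo1 => j k ltjk.
rewrite -(ltn_lift (p i)) -!(lift_perm_lift i) -def_p.
by apply: p_incr; rewrite ?inE 1?eq_sym ?neq_lift ?ltn_lift.
Qed.

Lemma ltn_permNge n (p : 'S_n) (i j : 'I_n) :
  i != j -> (p i < p j) = ~~ (p j < p i).
Proof.
by rewrite -leqNgt ltn_neqAle (inj_eq val_inj) (inj_eq perm_inj) => ->.
Qed.

Lemma same_orderP (s t : seq nat) :
  reflect (size s = size t /\
           forall i j, i < size s -> j < size s ->
             (nth 0 s i < nth 0 s j) = (nth 0 t i < nth 0 t j))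
          (same_order s t).
Proof.
apply: (iffP andP) => [[/eqP st /forallP st_lt]|[-> st_lt]]; split=> //.
  move=> i j lti ltj.
  by have /forallP/(_ (Ordinal ltj))/eqP := st_lt (Ordinal lti).
by apply/forallP=> i; apply/forallP=> j; rewrite st_lt.
Qed.

Lemma same_order_nil : same_order [::] [::].
Proof. by apply/same_orderP. Qed.

Lemma same_order_cons (x a : nat) (s t : seq nat) :
  same_order (x :: s) (a :: t) =
  all2 (fun y b => ((x < y) == (a < b)) && ((y < x) == (b < a))) s t
  && same_order s t.
Proof.
rewrite all2E; apply/same_orderP/andP => [[[st] st_lt]|].
  split; last by apply/same_orderP; split=> // i j; apply: (st_lt i.+1 j.+1).
  rewrite st eqxx; apply/(all_nthP (0, 0)) => i.
  rewrite size_zip -st minnn nth_zip //= => lti.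
  by rewrite (st_lt 0 i.+1) ?(st_lt i.+1 0) ?eqxx.
case=> /andP[/eqP st /(all_nthP (0, 0))]; rewrite size_zip -st minnn => x_lt.
case/same_orderP=> _ st_lt; split; first by rewrite /= st.
case=> [|i] [|j] //= lti ltj.
- by rewrite !ltnn.
- by have := x_lt j ltj; rewrite nth_zip //= => /andP[/eqP].
- by have := x_lt i lti; rewrite nth_zip //= => /andP[_ /eqP].
- exact: st_lt.
Qed.

Lemma same_order_sorted (s t : seq nat) :
  same_order s t -> sorted ltn s = sorted ltn t.
Proof.
elim: s t => [|x s IHs] [|a t] //; rewrite same_order_cons => /andP[x_lt st].
rewrite /= !(path_sortedE ltn_trans) (IHs t st); congr (_ && _).
elim: s t x_lt {IHs st} => [|y s IHs] [|b t] //=.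
by case/andP=> /andP[/eqP-> _] /IHs->.
Qed.

Lemma subseq_enum_ord n (s : seq 'I_n) : subseq s (enum 'I_n) = sorted <%O s.
Proof.
have enum_incr : sorted <%O (enum 'I_n).
  by have := iota_ltn_sorted 0 n; rewrite -val_enum_ord sorted_map.
apply/idP/idP => [s_sub|s_incr]; first exact: subseq_lt_sorted enum_incr.
have -> : s = [seq i <- enum 'I_n | i \in s].
  apply: lt_sorted_eq => // [|i]; first exact: lt_sorted_filter.
  by rewrite mem_filter mem_enum andbT.
exact: filter_subseq.
Qed.

Lemma contains_onelineP n (p : 'S_n) (sigma : seq nat) :
  reflect (exists2 s : seq 'I_n,
             sorted <%O s & same_order [seq (p i).+1 | i <- s] sigma)
          (contains (oneline p) sigma).
Proof.
apply: (iffP (containsP _ _)) => [[_ /subseqP[m _ ->]]|[s s_incr so]].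
  rewrite -map_mask => so; exists (mask m (enum 'I_n)) => //.
  by rewrite -subseq_enum_ord mask_subseq.
by exists [seq (p i).+1 | i <- s]; rewrite // map_subseq ?subseq_enum_ord.
Qed.

Lemma avoids_cons_homo n (p : 'S_n.+1) (a : nat) (t : seq nat) :
  {in predC1 ord0 &, {homo p : j k / j < k}} -> ~~ sorted ltn t ->
  avoids p (a :: t).
Proof.
move=> p_incr; apply: contra => /contains_onelineP[[|i s] //= s_incr].
rewrite same_order_cons => /andP[_ /same_order_sorted <-].
move: s_incr; rewrite lt_path_sortedE => /andP[/allP i_lt s_incr].
have s_neq0 : all (predC1 ord0) s.
  by apply/allP=> j /i_lt; rewrite ltEord /= -val_eqE /=; lia.
rewrite (map_comp S) sorted_map; apply: (homo_sorted_in _ s_neq0 s_incr).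
exact: p_incr.
Qed.

Lemma avoids_ltn n (p : 'S_n) (sigma : seq nat) (i j k : 'I_n) :
  avoids p sigma -> i < j -> j < k ->
  (p k < p j -> same_order [:: (p i).+1; (p j).+1; (p k).+1] sigma) ->
  p j < p k.
Proof.
move=> av ltij ltjk occurs; rewrite ltn_permNge ?lt_eqF //.
apply: contra av => /occurs so; apply/contains_onelineP.
by exists [:: i; j; k]; rewrite // /= !ltEord ltij ltjk.
Qed.

Lemma avoids321_ltn n (p : 'S_n) (i j k : 'I_n) :
  avoids p [:: 3; 2; 1] -> i < j -> p j < p i -> j < k -> p j < p k.
Proof.
move=> av ltij ltp ltjk; apply: avoids_ltn av ltij ltjk _ => ltpkj.
by rewrite !same_order_cons same_order_nil /=; lia.
Qed.

Lemma avoids132_ltn n (p : 'S_n) (i j k : 'I_n) :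
  avoids p [:: 1; 3; 2] -> i < j -> p i < p k -> j < k -> p j < p k.
Proof.
move=> av ltij ltp ltjk; apply: avoids_ltn av ltij ltjk _ => ltpkj.
by rewrite !same_order_cons same_order_nil /=; lia.
Qed.

Lemma avoids_inversion_homo n (p : 'S_n) (i j : 'I_n) :
  avoids p [:: 1; 3; 2] -> avoids p [:: 3; 2; 1] -> i < j -> p j < p i ->
  {in [pred k : 'I_n | j <= k] &, {homo p : k l / k < l}}.
Proof.
move=> av132 av321 ltij ltpji.
have ltpj (k : 'I_n) : j < k -> p j < p k := avoids321_ltn av321 ltij ltpji.
move=> k l; rewrite inE leq_eqVlt.
case/predU1P=> [/val_inj<- _ /ltpj //|ltjk _ ltkl].
by apply: (avoids132_ltn av132 ltjk) => //; apply/ltpj/(ltn_trans ltjk).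
Qed.

Lemma size_oneline n (p : 'S_n) : size (oneline p) = n.
Proof. by rewrite size_map size_enum_ord. Qed.

Lemma letter_oneline n (p : 'S_n) (i : 'I_n) :
  letter (oneline p) i.+1 = (p i).+1.
Proof. by rewrite /letter /= (nth_map i) ?size_enum_ord ?nth_ord_enum. Qed.

Lemma is_descentP n (p : 'S_n) (k : nat) :
  reflect (exists i j : 'I_n, [/\ i.+1 = k, j = k :> nat & p j < p i])
          (is_descent (oneline p) k).
Proof.
rewrite /is_descent size_oneline; apply: (iffP andP).
  case: k => [|k] [//= ltkn]; have ltk : k < n by apply: ltnW.
  rewrite (letter_oneline p (Ordinal ltk)) (letter_oneline p (Ordinal ltkn)).
  by rewrite ltnS => ltp; exists (Ordinal ltk), (Ordinal ltkn).
case=> i [j [<- def_j ltp]]; split; first by rewrite ltn0Sn -def_j ltn_ord.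
by rewrite -[in letter _ i.+2]def_j !letter_oneline ltnS.
Qed.

Lemma desarrangement_descent1 n (p : 'S_n) :
  0 < n -> desarrangement p -> is_descent (oneline p) 1.
Proof.
move=> n_gt0 /existsP[[[|[|i]] lti]] /andP[/andP[]] //= _.
move=> /forallP/(_ (Ordinal (isT : 1 < i.+2))).
by rewrite /is_ascent size_oneline /= n_gt0 => /negPn.
Qed.

Lemma descent1_desarrangement n (p : 'S_n) :
  is_descent (oneline p) 1 -> ~~ is_descent (oneline p) 2 -> desarrangement p.
Proof.
move=> des1 ndes2; have n_gt1 : 1 < n.
  by case/andP: des1; rewrite size_oneline.
apply/existsP; exists (Ordinal (n_gt1 : 2 < n.+1)); rewrite andbT.
rewrite /is_first_ascent {1}/is_ascent size_oneline ndes2 n_gt1 /=.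
by apply/forallP=> -[[|[|//]] lti]; rewrite /is_ascent //= des1 andbF.
Qed.

Lemma desarrangement_lift_perm1 n (a : 'I_n.+1) :
  a != ord0 -> desarrangement (lift_perm ord0 a 1).
Proof.
case: n a => [|n] a a_neq0; first by rewrite ord1 in a_neq0.
set p := lift_perm _ _ _; pose second : 'I_n.+2 := lift ord0 ord0.
have p_second : p second = ord0.
  apply: val_inj; rewrite lift_perm_lift perm1 /= /bump.
  by move: a_neq0; rewrite -val_eqE /=; lia.
apply: descent1_desarrangement.
  apply/is_descentP; exists ord0, second; rewrite p_second lift_perm_id.
  by rewrite lt0n.
apply/is_descentP=> -[i [j [[i_eq1] _]]].
by have -> : i = second by [apply: val_inj]; rewrite p_second.
Qed.

Lemma desarrangement_av132_av321E n :
  [set p : 'S_n.+1 |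
    desarrangement p && all (avoids p) [:: [:: 1; 3; 2]; [:: 3; 2; 1]]] =
  [set lift_perm ord0 a 1 | a in [set~ ord0]].
Proof.
apply/setP=> p; rewrite inE.
apply/and4P/imsetP => [[des av132 av321 _]|[a a_neq0 def_p]].
  have /is_descentP[i [j [[i_eq0] j_eq1 ltpji]]] :=
    desarrangement_descent1 (ltn0Sn n) des.
  have ltij : i < j by rewrite i_eq0 j_eq1.
  have def_i : i = ord0 by apply: val_inj.
  exists (p ord0); first by rewrite in_setC1 -val_eqE /= -def_i; lia.
  apply/eqP/lift_perm1_homoP.
  apply: sub_in2 (avoids_inversion_homo av132 av321 ltij ltpji) => k.
  by rewrite !inE -val_eqE /= j_eq1 lt0n.
rewrite in_setC1 in a_neq0.
have p_incr : {in predC1 ord0 &, {homo p : j k / j < k}}.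
  by apply/lift_perm1_homoP; rewrite def_p lift_perm_id.
split=> //; first by rewrite def_p desarrangement_lift_perm1.
  exact: avoids_cons_homo.
exact: avoids_cons_homo.
Qed.

Theorem theorem3p13 (n : nat) (hn : 1 <= n) :
  d n [:: [:: 1; 3; 2]; [:: 3; 2; 1]] = n - 1.
Proof.
case: n hn => // n _; rewrite /d subn1 desarrangement_av132_av321E.
rewrite card_imset; first by rewrite cardsC1 card_ord.
by move=> a b /permP/(_ ord0); rewrite !lift_perm_id.
Qed.
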